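(* Let $n \ge 1$ be a natural number and let $\mathcal{B}^*_n$ be the set of all $*$-positive matrices of order $n$. For every $A \in \mathcal{B}^*_n$, the matching factor $M^*(A)$ satisfies $$\frac{1}{n^{2n}} \le M^*(A) \le 1.$$ Moreover, both bounds are achieved, with $$\max_{A \in \mathcal{B}^*_n} M^*(A) = 1, \qquad \operatorname*{arg\,max}_{A \in \mathcal{B}^*_n} M^*(A) = \mathcal{P}^*_n,$$ and $$\min_{A \in \mathcal{B}^*_n} M^*(A) = \frac{1}{n^{2n}}, \qquad \operatorname*{arg\,min}_{A \in \mathcal{B}^*_n} M^*(A) = \mathcal{U}^*_n,$$ where $\mathcal{P}^*_n$ is the set of all $*$-permutation matrices of order $n$ and $\mathcal{U}^*_n$ is the set of all $*$-uniform matrices of order $n$. Here $\operatorname{arg\,max}$ and $\operatorname{arg\,min}$ denote the sets of all maximizers and all minimizers of $M^*$ over $\mathcal{B}^*_n$, respectively.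
   Context: A matrix of order $n$ is an $n \times n$ real matrix. It is non-negative if all its entries are non-negative. A non-negative matrix $A$ of order $n$ is $*$-positive if each row and each column contains at least one positive entry; $\mathcal{B}^*_n$ denotes the set of all such matrices. A non-negative matrix of order $n$ is a $*$-permutation matrix if each row and each column contains exactly one positive entry; $\mathcal{P}^*_n$ denotes the set of these. A $*$-uniform matrix of order $n$ is a $*$-positive matrix of order $n$ all of whose entries are equal; $\mathcal{U}^*_n$ denotes the set of these. For a matrix $A$ of order $n$, $A_{k.}$ denotes its $k$-th row, $A_{.k}$ its $k$-th column, and $\|\cdot\|_2$ the Euclidean norm. For a $*$-positive matrix $A$ of order $n$, the $k$-th matching factor is $$\lambda^*(k) = \frac{\|A_{k.}\|_2^2 \, \|A_{.k}\|_2^2}{\left(\sum_{i=1}^n A_{ki}\right)^2 \left(\sum_{j=1}^n A_{jk}\right)^2}, \qquad k = 1,\dots,n,$$ and the matching factor of $A$ is $M^*(A) = \prod_{k=1}^n \lambda^*(k)$. *)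

(* Defs.v *)
From mathcomp Require Import all_boot all_order all_algebra.
From mathcomp Require Import boolp classical_sets reals.
Set Implicit Arguments.
Unset Strict Implicit.
Unset Printing Implicit Defensive.
Import Order.TTheory GRing.Theory Num.Theory.

Local Open Scope classical_set_scope.
Local Open Scope ring_scope.

Definition nonneg_mx (R : realType) (n : nat) (A : 'M[R]_n) : Prop :=
  forall i j, 0 <= A i j.

Definition star_positive (R : realType) (n : nat) : set 'M[R]_n :=
  [set A | [/\ nonneg_mx A,
               forall i, exists j, 0 < A i j
             & forall j, exists i, 0 < A i j]].

Definition star_permutation (R : realType) (n : nat) : set 'M[R]_n :=
  [set A | [/\ nonneg_mx A,
               forall i, exists! j, 0 < A i j
             & forall j, exists! i, 0 < A i j]].

Definition star_uniform (R : realType) (n : nat) : set 'M[R]_n :=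
  [set A | star_positive A /\ forall i j k l, A i j = A k l].

(* Applied below to rows ('rV) and columns ('cV), so that one of the two sums
   has a single term.  The norm `|v| that MathComp-Analysis puts on matrices is
   the sup norm, hence this definition. *)
Definition norm2 (R : realType) (m n : nat) (v : 'M[R]_(m, n)) : R :=
  Num.sqrt (\sum_i \sum_j v i j ^+ 2).

Definition matching_factor_at (R : realType) (n : nat) (A : 'M[R]_n)
    (k : 'I_n) : R :=
  (norm2 (row k A) ^+ 2 * norm2 (col k A) ^+ 2) /
  ((\sum_i A k i) ^+ 2 * (\sum_j A j k) ^+ 2).

Definition matching_factor (R : realType) (n : nat) (A : 'M[R]_n) : R :=
  \prod_k matching_factor_at A k.

Definition argmax (T : Type) (R : realType) (S : set T) (f : T -> R) : set T :=
  [set x | S x /\ forall y, S y -> f y <= f x].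

Definition argmin (T : Type) (R : realType) (S : set T) (f : T -> R) : set T :=
  [set x | S x /\ forall y, S y -> f x <= f y].

Definition is_maximum (R : realType) (E : set R) (m : R) : Prop :=
  E m /\ ubound E m.

Definition is_minimum (R : realType) (E : set R) (m : R) : Prop :=
  E m /\ lbound E m.

(* Main.v *)
(** Each factor [lambda^*(k)] is a product of two ratios
    [sum v_i^2 / (sum v_i)^2], one for row [k] and one for column [k].  On a nonzero
    nonnegative vector this ratio lies between [1/n] and [1]:
    [sum v_i^2 - (sum v_i)^2 / n] is the sum of squared deviations from the mean,
    and [(sum v_i)^2 - sum v_i^2] is the sum of the products [v_i v_j], [i <> j].
    A product of positive factors attains a factorwise bound only if every factor
    does, so extremal matrices have all rows and columns constant, or all rows and
    columns with a single positive entry. *)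
Require Import Defs.
From mathcomp Require Import all_boot all_order all_algebra.
From mathcomp Require Import boolp classical_sets reals.
From mathcomp Require Import ring.
Import Order.TTheory GRing.Theory Num.Theory.
Local Open Scope classical_set_scope.
Local Open Scope ring_scope.

(** On nonnegative vectors this is the squared ratio of the 2-norm to the 1-norm. Taking a function
    as argument lets [A k] and [A^~ k] treat rows and columns alike. *)
Definition concentration {R : realType} {n : nat} (v : 'I_n -> R) : R :=
  (\sum_i v i ^+ 2) / (\sum_i v i) ^+ 2.

Lemma matching_factorE (R : realType) (n : nat) (A : 'M[R]_n) :
  matching_factor A =
  \prod_k (concentration (A k) * concentration (A^~ k)).
Proof.
apply: eq_bigr => k _.
rewrite /matching_factor_at /norm2 /concentration mulf_div !sqr_sqrtr.
- congr (_ * _ / _).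
  + by rewrite big_ord1; under eq_bigr do rewrite mxE.
  + by apply: eq_bigr => i _; rewrite big_ord1 mxE.
- by apply: sumr_ge0 => i _; apply: sumr_ge0 => j _; rewrite sqr_ge0.
- by apply: sumr_ge0 => i _; apply: sumr_ge0 => j _; rewrite sqr_ge0.
Qed.

Section Concentration.
Variables (R : realType) (n : nat) (v : 'I_n -> R).
Hypotheses (v_ge0 : forall i, 0 <= v i) (v_pos : exists i, 0 < v i).

Let n_gt0 : (0 < n)%N.
Proof. by have [i _] := v_pos; case: n i => [[]|]. Qed.

Let n_neq0 : n%:R != 0 :> R.
Proof. by rewrite pnatr_eq0 -lt0n. Qed.

Let sum_gt0 : 0 < \sum_i v i.
Proof.
have [i vi_gt0] := v_pos.
by rewrite (bigD1 i) //= ltr_pwDl // sumr_ge0.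
Qed.

Lemma sum_sqr_deviation :
  \sum_i (v i - (\sum_j v j) / n%:R) ^+ 2 =
  \sum_i v i ^+ 2 - (\sum_i v i) ^+ 2 / n%:R.
Proof.
set s := \sum_j v j.
under eq_bigr do rewrite sqrrB.
rewrite big_split sumrB /= sumr_const card_ord sumrMnl -mulr_suml -/s.
by field.
Qed.

Lemma concentration_ge : n%:R^-1 <= concentration v.
Proof.
rewrite ler_pdivlMr ?exprn_gt0 // mulrC -subr_ge0 -sum_sqr_deviation.
by apply: sumr_ge0 => i _; rewrite sqr_ge0.
Qed.

Lemma concentration_eq_inv :
  concentration v = n%:R^-1 <-> forall i j, v i = v j.
Proof.
have s2_neq0 : (\sum_i v i) ^+ 2 != 0 by rewrite expf_neq0 ?gt_eqF.
split=> [/(canRL (divfK s2_neq0)) eq_inv i j|v_const].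
  have : \sum_i (v i - (\sum_j v j) / n%:R) ^+ 2 == 0.
    by rewrite sum_sqr_deviation eq_inv mulrC subrr.
  rewrite psumr_eq0 => [/allP dev0|k _]; last by rewrite sqr_ge0.
  have v_mean k : v k = (\sum_j v j) / n%:R.
    apply/eqP; rewrite -subr_eq0 -sqrf_eq0; exact: dev0 (mem_index_enum k).
  by rewrite !v_mean.
(* With common value [v i], the ratio is [n * v i ^+ 2] over [(n * v i) ^+ 2]; positivity of [v i]
   permits the cancellation. *)
have [i vi_gt0] := v_pos; rewrite /concentration.
under eq_bigr do rewrite (v_const _ i).
under [in X in _ / X]eq_bigr do rewrite (v_const _ i).
rewrite !sumr_const card_ord -[v i ^+ 2 *+ n]mulr_natl -[v i *+ n]mulr_natl.
by have vi_neq0 := lt0r_neq0 vi_gt0; field; rewrite n_neq0.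
Qed.

Lemma sqr_sum_sub_sum_sqr :
  (\sum_i v i) ^+ 2 - \sum_i v i ^+ 2 =
  \sum_i v i * \sum_(j | j != i) v j.
Proof.
rewrite expr2 mulr_suml -sumrB; apply: eq_bigr => i _.
by rewrite [in X in X - _](bigD1 i) //= mulrDr -expr2 addrC addKr.
Qed.

Let cross_ge0 i : 0 <= v i * \sum_(j | j != i) v j.
Proof. by rewrite mulr_ge0 ?sumr_ge0. Qed.

Lemma concentration_le1 : concentration v <= 1.
Proof.
rewrite ler_pdivrMr ?exprn_gt0 // mul1r -subr_ge0 sqr_sum_sub_sum_sqr.
exact: sumr_ge0.
Qed.

Lemma concentration_eq1 : concentration v = 1 <-> exists! i, 0 < v i.
Proof.
have s2_neq0 : (\sum_i v i) ^+ 2 != 0 by rewrite expf_neq0 ?gt_eqF.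
split=> [/(canRL (divfK s2_neq0)) eq1|[i [vi_gt0 i_uniq]]].
  have : \sum_i v i * \sum_(j | j != i) v j == 0.
    by rewrite -sqr_sum_sub_sum_sqr eq1 mul1r subrr.
  rewrite psumr_eq0 // => /allP cross0.
  (* A second positive entry [v j] would make the cross term at [i] positive, although all cross
     terms vanish. *)
  have [i vi_gt0] := v_pos; exists i; split=> // j vj_gt0.
  apply/esym/eqP; apply: contraTT (cross0 i (mem_index_enum i)) => ji.
  rewrite mulf_neq0 ?gt_eqF // (bigD1 j) //= ltr_pwDl //.
  exact: sumr_ge0.
have v0 j : j != i -> v j = 0.
  move=> ji; apply/eqP; rewrite eq_sym; apply: contraTT ji => vj.
  by rewrite negbK (i_uniq j) // lt_neqAle vj v_ge0.
rewrite /concentration (bigD1 i) //= [X in _ + X]big1 ?addr0; last first.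
  by move=> j /v0 ->; rewrite expr0n.
rewrite (bigD1 i) //= [X in _ + X]big1 ?addr0 //.
by rewrite divff // expf_neq0 ?gt_eqF.
Qed.

End Concentration.

Section MatchingFactor.
Variables (R : realType) (n : nat) (A : 'M[R]_n).
Hypothesis A_pos : star_positive A.

Let row_ge0 i j : 0 <= A i j. Proof. by case: A_pos. Qed.
Let row_pos i : exists j, 0 < A i j. Proof. by case: A_pos. Qed.
Let col_pos j : exists i, 0 < A i j. Proof. by case: A_pos. Qed.

(** The [?= iff] form carries the bound and its equality case together through both the row-column
    product and the product over [k]. *)
Lemma matching_factor_ge_leif :
  1 / n%:R ^+ (2 * n) <= matching_factor A ?= iff
  [forall k, (n%:R^-1 == concentration (A k)) &&
             (n%:R^-1 == concentration (A^~ k))].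
Proof.
have ge_row k := @concentration_ge _ _ (A k) (row_ge0 k) (row_pos k).
have ge_col k := @concentration_ge _ _ (A^~ k) (row_ge0^~ k) (col_pos k).
have inv_gt0 (k : 'I_n) : 0 < n%:R^-1 :> R.
  by rewrite invr_gt0 ltr0n (leq_trans _ (ltn_ord k)).
have conc_gt0 (k : 'I_n) : 0 < concentration (A k) * concentration (A^~ k).
  by rewrite mulr_gt0 // (lt_le_trans (inv_gt0 k)).
(* Each of the [n] indices contributes one [n%:R^-1] for its row and one for its column. *)
have -> : 1 / n%:R ^+ (2 * n) = \prod_(k < n) (n%:R^-1 * n%:R^-1) :> R.
  by rewrite prodr_const card_ord -expr2 -exprM exprVn div1r.
rewrite matching_factorE.
(* [leif_pprod] also allows equality when the larger product is zero; positivity of the factors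
   excludes this, and [orFb] puts the goal in the matching disjunctive shape. *)
have M_neq0 : \prod_k (concentration (A k) * concentration (A^~ k)) == 0 = false.
  by rewrite gt_eqF // prodr_gt0.
rewrite -[[forall k, _]]orFb -M_neq0.
apply: leif_pprod => k _; first by rewrite mulr_ge0 // ltW ?inv_gt0.
have := leif_pM (ltW (inv_gt0 k)) (ltW (inv_gt0 k))
  (leif_eq (ge_row k)) (leif_eq (ge_col k)).
by rewrite gt_eqF.
Qed.

Lemma matching_factor_le_leif :
  matching_factor A <= 1 ?= iff
  [forall k, (concentration (A k) == 1) && (concentration (A^~ k) == 1)].
Proof.
have conc_ge0 (v : 'I_n -> R) : 0 <= concentration v.
  by rewrite divr_ge0 ?sqr_ge0 // sumr_ge0 // => i _; rewrite sqr_ge0.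
have le_row k := @concentration_le1 _ _ (A k) (row_ge0 k) (row_pos k).
have le_col k := @concentration_le1 _ _ (A^~ k) (row_ge0^~ k) (col_pos k).
rewrite matching_factorE.
(* The bound 1 is spelled out as a product so that the comparison can be made factor by factor. *)
have prod1 : \prod_(k < n) (1 * 1) = 1 :> R by rewrite big1 // => k; rewrite mulr1.
have prod1_neq0 : \prod_(k < n) (1 * 1) == 0 :> R = false.
  by rewrite prod1 oner_eq0.
rewrite -[[forall k, _]]orFb -prod1_neq0 -[X in Order.leif _ X _]prod1.
apply: leif_pprod => k _; first by rewrite mulr_ge0.
have := leif_pM (conc_ge0 _) (conc_ge0 _)
  (leif_eq (le_row k)) (leif_eq (le_col k)).
by rewrite mulr1 oner_eq0.
Qed.

Lemma matching_factor_eq_min :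
  matching_factor A = 1 / n%:R ^+ (2 * n) <-> star_uniform A.
Proof.
have eq_row k := @concentration_eq_inv _ _ (A k) (row_ge0 k) (row_pos k).
have eq_col k := @concentration_eq_inv _ _ (A^~ k) (row_ge0^~ k) (col_pos k).
have [_ eq_min] := matching_factor_ge_leif; split=> [M_min|[_ A_const]].
  move: eq_min; rewrite M_min eqxx => /esym/forallP conc_min; split=> // i j k l.
  (* Positions [(i, j)] and [(k, l)] are linked through [(i, l)]: along row [i], then along column
     [l]. *)
  have /andP[/eqP/esym/eq_row Ai_const _] := conc_min i.
  have /andP[_ /eqP/esym/eq_col Al_const] := conc_min l.
  by rewrite (Ai_const j l) (Al_const i k).
apply/esym/eqP; rewrite eq_min; apply/forallP => k.
by apply/andP; split; apply/eqP/esym; [apply/eq_row|apply/eq_col] => i j;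
  apply: A_const.
Qed.

Lemma matching_factor_eq_max :
  matching_factor A = 1 <-> star_permutation A.
Proof.
have eq_row k := @concentration_eq1 _ _ (A k) (row_ge0 k) (row_pos k).
have eq_col k := @concentration_eq1 _ _ (A^~ k) (row_ge0^~ k) (col_pos k).
have [_ eq_max] := matching_factor_le_leif; split=> [M_max|[_ A_row A_col]].
  move: eq_max; rewrite M_max eqxx => /esym/forallP conc_max.
  by split=> // k; have /andP[/eqP/eq_row ? /eqP/eq_col] := conc_max k.
apply/eqP; rewrite eq_max; apply/forallP => k.
by apply/andP; split; apply/eqP; [apply/eq_row|apply/eq_col].
Qed.

End MatchingFactor.

Lemma star_permutation_positive (R : realType) (n : nat) :
  @star_permutation R n `<=` @star_positive R n.
Proof.
move=> A [A_ge0 A_row A_col]; split=> // k.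
  by have [j [? _]] := A_row k; exists j.
by have [i [? _]] := A_col k; exists i.
Qed.

Lemma star_permutation_id (R : realType) (n : nat) :
  @star_permutation R n 1%:M.
Proof.
have pos_id (i j : 'I_n) : 0 < (1%:M : 'M[R]_n) i j -> i = j.
  by rewrite mxE; case: eqP => // _; rewrite ltxx.
split=> [i j|i|i]; first by rewrite mxE ler0n.
- by exists i; split=> [|j /pos_id //]; rewrite mxE eqxx ltr01.
- by exists i; split=> [|j /pos_id //]; rewrite mxE eqxx ltr01.
Qed.

Lemma star_uniform_const1 (R : realType) (n : nat) :
  @star_uniform R n (const_mx 1).
Proof.
split=> [|i j k l]; last by rewrite !mxE.
split=> [i j|i|i]; first by rewrite mxE.
- by exists i; rewrite mxE.
- by exists i; rewrite mxE.
Qed.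

Theorem theorem2 (R : realType) (n : nat) (n_ge1 : (1 <= n)%N) :
  (forall A : 'M[R]_n, star_positive A ->
     1 / n%:R ^+ (2 * n) <= matching_factor A <= 1) /\
  (is_maximum (@matching_factor R n @` @star_positive R n) 1 /\
   argmax (@star_positive R n) (@matching_factor R n) = @star_permutation R n) /\
  (is_minimum (@matching_factor R n @` @star_positive R n)
     (1 / n%:R ^+ (2 * n)) /\
   argmin (@star_positive R n) (@matching_factor R n) = @star_uniform R n).
Proof.
have M_ge A (A_pos : star_positive A) := (@matching_factor_ge_leif R n A A_pos).1.
have M_le A (A_pos : star_positive A) := (@matching_factor_le_leif R n A A_pos).1.
have P_perm := @star_permutation_id R n.
have P_pos := @star_permutation_positive R n _ P_perm.
have P_max := (matching_factor_eq_max _ _ _ P_pos).2 P_perm.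
have U_unif := @star_uniform_const1 R n; have [U_pos _] := U_unif.
have U_min := (matching_factor_eq_min _ _ _ U_pos).2 U_unif.
split=> [A A_pos|]; first by rewrite M_ge ?M_le.
split; split.
- by split=> [|_ [A A_pos <-]]; [exists 1%:M | exact: M_le].
- apply/seteqP; split=> [A [A_pos A_max]|A A_perm].
    (* A maximizer does at least as well as the identity matrix, whose value is 1, so the upper
       bound forces equality. *)
    apply/matching_factor_eq_max => //; apply/le_anti.
    by rewrite M_le //= -P_max A_max.
  have A_pos := @star_permutation_positive R n _ A_perm; split=> // B B_pos.
  by rewrite ((matching_factor_eq_max _ _ _ A_pos).2 A_perm) M_le.
- by split=> [|_ [A A_pos <-]]; [exists (const_mx 1) | exact: M_ge].
- apply/seteqP; split=> [A [A_pos A_min]|A A_unif].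
    (* Dually, a minimizer is compared with the all-ones matrix, which attains the lower bound. *)
    apply/matching_factor_eq_min => //; apply/le_anti.
    by rewrite M_ge // andbT -U_min A_min.
  have [A_pos _] := A_unif; split=> // B B_pos.
  by rewrite ((matching_factor_eq_min _ _ _ A_pos).2 A_unif) M_ge.
Qed.
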